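(* Let $(a_k)_{k\ge1}$ be a sequence of positive integers. If there exists an integer $m\ge0$ such that the infinite word $a_{m+1}a_{m+2}\ldots$ is recurrent, then the real number $\alpha:=[0;a_1,a_2,\ldots]$ satisfies $$\lim_{n\to+\infty}c(n\alpha)=0$$ and, moreover, $$c(n\alpha)\le\frac{8q_m^2}{n},\qquad\text{for every integer } n\ge1,$$ where $q_m$ denotes the denominator of the rational number $[0;a_1,\ldots,a_m]$.
   Context: $\Vert x\Vert$ denotes the distance from the real number $x$ to the nearest integer. $[0;a_1,a_2,\ldots]$ denotes the continued fraction with partial quotients $a_1,a_2,\ldots$; $q_m$ is the denominator in lowest terms of $[0;a_1,\ldots,a_m]$, with $q_0=1$. An infinite word is recurrent if every finite block (of consecutive letters) occurring in it occurs infinitely often. The Lagrange constant of an irrational real number $\beta$ is $c(\beta):=\liminf_{q\to+\infty}q\cdot\Vert q\beta\Vert$ ($q$ ranging over positive integers). *)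

(* Defs.v *)
From HB Require Import structures.
From mathcomp Require Import all_boot all_order all_algebra.
From mathcomp Require Import all_classical all_reals all_analysis.

Set Implicit Arguments.
Unset Strict Implicit.
Unset Printing Implicit Defensive.

Import Order.TTheory GRing.Theory Num.Theory.
Import numFieldNormedType.Exports.

Local Open Scope classical_set_scope.
Local Open Scope ring_scope.

(* The infimum is attained, at an integer nearest to x. *)
Definition dist_int (R : realType) (x : R) : R :=
  inf [set `|x - k%:~R| | k in [set: int]].

(* The liminf is taken in the extended reals, so that it needs no boundedness
   assumption; the term q = 0 does not affect it. *)
Definition lagrange_constant (R : realType) (beta : R) : \bar R :=
  limn_einf (fun q : nat => (q%:R * dist_int (q%:R * beta))%:E).

(* cf_finite [:: b_1; ...; b_l] = [0; b_1, ..., b_l] *)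
Fixpoint cf_finite (s : seq nat) : rat :=
  if s is b :: s' then (b%:R + cf_finite s')^-1 else 0.

(* Sequences (a_k) with k >= 1 are functions on nat whose value at 0 is never
   used: cf_convergent a m = [0; a_1, ..., a_m]. *)
Definition cf_convergent (a : nat -> nat) (m : nat) : rat :=
  cf_finite [seq a k | k <- iota 1 m].

(* denq is the positive denominator of the reduced fraction. *)
Definition cf_denom (a : nat -> nat) (m : nat) : int :=
  denq (cf_convergent a m).

(* [0; a_1, a_2, ...]; the limit exists when a_k > 0 for all k >= 1. *)
Definition cf_infinite (R : realType) (a : nat -> nat) : R :=
  limn (fun m : nat => ratr (cf_convergent a m) : R).

Definition occurs_at (T : Type) (w : nat -> T) (u : seq T) (i : nat) : Prop :=
  [seq w k | k <- iota i (size u)] = u.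

Definition recurrent_word (T : Type) (w : nat -> T) : Prop :=
  forall u : seq T,
    (exists i : nat, occurs_at w u i) ->
    infinite_set [set i : nat | occurs_at w u i].

(* Main.v *)
Require Import Defs.
From HB Require Import structures.
From mathcomp Require Import all_boot all_order all_algebra.
From mathcomp Require Import fingroup perm ring lra zify.
From mathcomp Require Import all_classical all_reals all_analysis.

Set Implicit Arguments.
Unset Strict Implicit.
Unset Printing Implicit Defensive.

Import Order.TTheory GRing.Theory Num.Theory.
Import numFieldNormedType.Exports.

Local Open Scope classical_set_scope.
Local Open Scope ring_scope.

(** The step (q_(k-1), q_k) |-> (q_k, a_(k+1) q_k + q_(k-1)), reduced modulo n,
    is a permutation of a finite set. For a recurrent word, the group elements
    that are products over prefixes followed by arbitrarily long copies of the
    beginning of the word form a nonempty subsemigroup, hence include 1. So for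
    infinitely many j, (q_(m+j-1), q_(m+j)) = (q_(m-1), q_m) modulo n, and
    D = |q_m q_(m+j-1) - q_(m-1) q_(m+j)| is a nonzero multiple of n with
    D <= q_m q_(m+j) and ||D alpha|| <= 2 q_m / q_(m+j). Taking Q = D / n gives
    Q ||Q n alpha|| <= 2 q_m^2 / n. *)

(** * Continued fractions: recurrences, reduced convergents, approximation of the limit *)

Definition cf_step (v : nat * nat) (b : nat) : nat * nat :=
  (v.2, (b * v.2 + v.1)%N).

(* With v = (0, 1) this is (q_(k-1), q_k), with v = (1, 0) it is
   (p_(k-1), p_k), where q_(-1) = 0 and p_(-1) = 1. *)
Definition cf_rec (v : nat * nat) (a : nat -> nat) (k : nat) : nat * nat :=
  foldl cf_step v [seq a i | i <- iota 1 k].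

Lemma cf_recS (v : nat * nat) (a : nat -> nat) (k : nat) :
  cf_rec v a k.+1 = cf_step (cf_rec v a k) (a k.+1).
Proof. by rewrite /cf_rec -[in LHS](addn1 k) iotaD map_cat foldl_cat add1n. Qed.

Lemma cf_recD (v : nat * nat) (a : nat -> nat) (k l : nat) :
  cf_rec v a (k + l) =
  foldl cf_step (cf_rec v a k) [seq a i | i <- iota k.+1 l].
Proof. by rewrite /cf_rec iotaD map_cat foldl_cat add1n. Qed.

Lemma cf_finite_ge0 (s : seq nat) : 0 <= cf_finite s.
Proof. by elim: s => //= b s IH; rewrite invr_ge0 addr_ge0. Qed.

Lemma cf_finite_le1 (s : seq nat) : all (leq 1) s -> cf_finite s <= 1.
Proof.
case: s => //= b s /andP[b_gt0 _]; rewrite invf_le1.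
  by rewrite (le_trans (_ : 1 <= b%:R)) ?ler1n// lerDl cf_finite_ge0.
by rewrite ltr_pwDl ?ltr0n// cf_finite_ge0.
Qed.

(* The last entry is linear in v, and cf_finite s is the ratio of its two
   coefficients. *)
Lemma foldl_cf_step (s : seq nat) (v : nat * nat) : all (leq 1) s ->
  (foldl cf_step v s).2%:R =
  (foldl cf_step (0%N, 1%N) s).2%:R * (v.2%:R + cf_finite s * v.1%:R).
Proof.
elim: s v => [v _|b s IH v /=/andP[b_gt0 s_gt0]] /=.
  by rewrite mul0r addr0 mul1r.
rewrite [LHS](IH _ s_gt0) [in RHS](IH _ s_gt0)/= !natrD !natrM.
have : b%:R + cf_finite s != 0.
  by rewrite gt_eqF// ltr_pwDl ?ltr0n// cf_finite_ge0.
move: (cf_finite s) => x bx0; field; exact: bx0.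
Qed.

Lemma cf_rec_det (a : nat -> nat) (k : nat) :
  (cf_rec (1, 0)%N a k).2%:Z * (cf_rec (0, 1)%N a k).1%:Z
  - (cf_rec (1, 0)%N a k).1%:Z * (cf_rec (0, 1)%N a k).2%:Z = - (-1) ^+ k.
Proof.
elim: k => [//|k IH]; rewrite !cf_recS/= exprS mulN1r -IH.
by rewrite !PoszD !PoszM; ring.
Qed.

Lemma coprime_of_det (x y z t : nat) (e : int) :
  x%:Z * y%:Z - z%:Z * t%:Z = e -> `|e|%N = 1%N -> coprime x t.
Proof.
move=> xyzt e1; rewrite /coprime -dvdn1 -e1 -xyzt.
rewrite -[gcdn x t]/`|(gcdn x t)%:Z|%N.
rewrite -dvdzE rpredB//.
  by rewrite dvdz_mulr// dvdzE dvdn_gcdl.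
by rewrite dvdz_mull// dvdzE dvdn_gcdr.
Qed.

Lemma all_iota_gt0 (a : nat -> nat) (k l : nat) :
  (forall k, (1 <= k)%N -> (0 < a k)%N) ->
  all (leq 1) [seq a i | i <- iota k.+1 l].
Proof.
move=> a_gt0; apply/allP => _ /mapP[i + ->]; rewrite mem_iota => /andP[ki _].
by apply: a_gt0; exact: leq_trans ki.
Qed.

Lemma cf_den_mono (a : nat -> nat) (k : nat) :
  (forall k, (1 <= k)%N -> (0 < a k)%N) ->
  ((cf_rec (0, 1)%N a k).1 <= (cf_rec (0, 1)%N a k).2)%N /\
  (0 < (cf_rec (0, 1)%N a k).2)%N.
Proof.
move=> a_gt0; elim: k => [//|k IH]; rewrite cf_recS /=.
by have := a_gt0 k.+1 isT; nia.
Qed.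

Lemma cf_den_geq (a : nat -> nat) (k : nat) :
  (forall k, (1 <= k)%N -> (0 < a k)%N) -> (k <= (cf_rec (0, 1)%N a k).2)%N.
Proof.
(* The induction starts at k = 1, because q_(-1) = 0; from there on the term q_(k-1) >= 1 supplies
   the increment. *)
move=> a_gt0; case: k => [//|]; elim=> [|k IH]; rewrite cf_recS/=.
  by have := a_gt0 1%N isT; rewrite /cf_rec /=; lia.
move: IH; rewrite cf_recS/=.
by have := cf_den_mono k a_gt0; have := a_gt0 k.+2 isT; nia.
Qed.

(** The indices must differ by at least 2: q_1 = q_0 = 1 when a_1 = 1. *)
Lemma cf_den_ltn (a : nat -> nat) (k l : nat) :
  (forall k, (1 <= k)%N -> (0 < a k)%N) -> (k.+1 < l)%N ->
  ((cf_rec (0, 1)%N a k).2 < (cf_rec (0, 1)%N a l).2)%N.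
Proof.
move=> a_gt0; elim: l => // l IH; rewrite ltnS leq_eqVlt => /orP[/eqP <-|/IH].
  rewrite !cf_recS /=; have := cf_den_mono k a_gt0.
  by have := a_gt0 k.+1 isT; have := a_gt0 k.+2 isT; nia.
by rewrite cf_recS/=; have := a_gt0 l.+1 isT; nia.
Qed.

Lemma coprime_cf_den (a : nat -> nat) (k : nat) :
  coprime (cf_rec (0, 1)%N a k).1 (cf_rec (0, 1)%N a k).2.
Proof.
have := cf_rec_det a k; rewrite mulrC => /coprime_of_det; apply.
by rewrite abszN abszX exp1n.
Qed.

Lemma cf_convergentE (a : nat -> nat) (k : nat) :
  (forall k, (1 <= k)%N -> (0 < a k)%N) ->
  cf_convergent a k =
  (cf_rec (1, 0)%N a k).2%:R / (cf_rec (0, 1)%N a k).2%:R.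
Proof.
move=> a_gt0; rewrite [in RHS]/cf_rec foldl_cf_step ?all_iota_gt0//=.
rewrite add0r mulr1 mulrC mulKf// pnatr_eq0 -lt0n.
by case: (cf_den_mono k a_gt0) => _.
Qed.

(** The determinant being 1 or -1, the fraction p_k / q_k is already in lowest terms. *)
Lemma cf_denomE (a : nat -> nat) (k : nat) :
  (forall k, (1 <= k)%N -> (0 < a k)%N) ->
  cf_denom a k = (cf_rec (0, 1)%N a k).2.
Proof.
move=> a_gt0; rewrite /cf_denom cf_convergentE// !pmulrn coprimeq_den.
  by case: (cf_den_mono k a_gt0) => _; case: _.2.
have /coprime_of_det := cf_rec_det a k; apply.
by rewrite abszN abszX exp1n.
Qed.

(* Each convergent of index l >= k is (p_k + x p_(k-1)) / (q_k + x q_(k-1)) for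
   some 0 <= x <= 1. *)
Lemma cf_convergent_dist (a : nat -> nat) (k l : nat) :
  (forall k, (1 <= k)%N -> (0 < a k)%N) -> (k <= l)%N ->
  let q := cf_rec (0, 1)%N a k in
  let p := cf_rec (1, 0)%N a k in
  `|q.1%:R * cf_convergent a l - p.1%:R| <= q.2%:R^-1 /\
  `|q.2%:R * cf_convergent a l - p.2%:R| <= q.2%:R^-1.
Proof.
move=> a_gt0 kl q p; rewrite cf_convergentE// -(subnKC kl) !cf_recD -/p -/q.
set s := [seq a i | i <- iota k.+1 (l - k)].
have s_gt0 : all (leq 1) s by exact: all_iota_gt0.
have [_] := cf_den_mono k a_gt0; rewrite -/q => q_gt0.
have : (foldl cf_step q s).2%:R != 0 :> rat.
  rewrite /q -cf_recD subnKC// pnatr_eq0 -lt0n.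
  by case: (cf_den_mono l a_gt0) => _.
rewrite (foldl_cf_step p s_gt0) (foldl_cf_step q s_gt0).
move: (foldl _ _ _).2%:R => c; rewrite mulf_eq0 negb_or => /andP[c0 qx0].
have [x0 x1] := (cf_finite_ge0 s, cf_finite_le1 s_gt0).
have /(congr1 (intr : int -> rat)) := cf_rec_det a k.
rewrite rmorphB !rmorphM rmorphN rmorphXn rmorphN1 /= -!pmulrn -/p -/q => det.
have e1 : `|(-1) ^+ k| = 1 :> rat by rewrite normrX normrN1 expr1n.
move: (cf_finite s) => x in x0 x1 qx0 *.
have qx : q.2%:R <= q.2%:R + x * q.1%:R :> rat by rewrite lerDl mulr_ge0.
have q20 : 0 < q.2%:R :> rat by rewrite ltr0n.
have {qx0} qx_gt0 := lt_le_trans q20 qx.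
have qxV : (q.2%:R + x * q.1%:R)^-1 <= q.2%:R^-1 by rewrite lef_pV2 ?posrE.
split.
  (* Over the common denominator only the determinant of [cf_rec_det] survives; in the second bound
     it comes with a factor -x, and x <= 1. *)
  rewrite (_ : _ - _ = - (-1) ^+ k / (q.2%:R + x * q.1%:R)).
    by rewrite normrM normrN e1 mul1r gtr0_norm ?invr_gt0.
  by rewrite -det; field; rewrite c0 gt_eqF.
rewrite (_ : _ - _ = x * (-1) ^+ k / (q.2%:R + x * q.1%:R)).
  rewrite !normrM e1 mulr1 ger0_norm// gtr0_norm ?invr_gt0//.
  by rewrite -[leRHS]mul1r ler_pM// ltW// invr_gt0.
by rewrite -[_ ^+ _]opprK -det; field; rewrite c0 gt_eqF.
Qed.

Lemma ratr_cf_convergent_dist (R : realType) (a : nat -> nat) (k l : nat) :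
  (forall k, (1 <= k)%N -> (0 < a k)%N) -> (k <= l)%N ->
  let q := cf_rec (0, 1)%N a k in
  let p := cf_rec (1, 0)%N a k in
  `|q.1%:R * ratr (cf_convergent a l) - p.1%:R| <= q.2%:R^-1 :> R /\
  `|q.2%:R * ratr (cf_convergent a l) - p.2%:R| <= q.2%:R^-1 :> R.
Proof.
move=> a_gt0 kl q p; have [] := cf_convergent_dist a_gt0 kl; rewrite -/q -/p.
rewrite -2!(ler_rat R) !ratr_norm !rmorphB !rmorphM fmorphV /= !ratr_nat.
by split.
Qed.

Lemma cvg_cf_convergent (R : realType) (a : nat -> nat) :
  (forall k, (1 <= k)%N -> (0 < a k)%N) ->
  cvgn (fun m => ratr (cf_convergent a m) : R).
Proof.
move=> a_gt0; apply: cauchy_cvg; apply: cauchy_exP => e e_gt0.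
(* Since q_k >= k > 1/e, every convergent of index at least k is within q_k^(-2) < e of p_k /
   q_k. *)
set k := Num.bound e^-1.
set q := cf_rec (0, 1)%N a k; set p := cf_rec (1, 0)%N a k.
exists (p.2%:R / q.2%:R); exists k => // l /= kl.
have [_ le_q] := ratr_cf_convergent_dist R a_gt0 kl; rewrite -/q -/p in le_q.
have [_ q_gt0] := cf_den_mono k a_gt0; rewrite -/q in q_gt0.
have qR_gt0 : 0 < q.2%:R :> R by rewrite ltr0n.
have q_lt : e^-1 < q.2%:R.
  apply: lt_le_trans (archi_boundP _) _; first by rewrite invr_ge0 ltW.
  by rewrite ler_nat cf_den_geq.
rewrite /ball /= distrC.
rewrite (_ : _ - _ = (q.2%:R * ratr (cf_convergent a l) - p.2%:R) / q.2%:R).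
  rewrite normrM normfV (gtr0_norm qR_gt0) ltr_pdivrMr//.
  rewrite (le_lt_trans le_q)// (lt_le_trans (_ : _ < e))//.
    by rewrite invf_plt ?posrE.
  by rewrite ler_peMr ?ler1n// ltW.
by field; rewrite gt_eqF.
Qed.

Lemma cf_infinite_dist (R : realType) (a : nat -> nat) (k : nat) :
  (forall k, (1 <= k)%N -> (0 < a k)%N) ->
  let q := cf_rec (0, 1)%N a k in
  let p := cf_rec (1, 0)%N a k in
  `|q.1%:R * cf_infinite R a - p.1%:R| <= q.2%:R^-1 /\
  `|q.2%:R * cf_infinite R a - p.2%:R| <= q.2%:R^-1.
Proof.
move=> a_gt0 q p; have cvg_a := cvg_cf_convergent (R := R) a_gt0.
suff H (x y : R) : (forall l, (k <= l)%N ->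
    `|x * ratr (cf_convergent a l) - y| <= q.2%:R^-1) ->
  `|x * cf_infinite R a - y| <= q.2%:R^-1.
  by split; apply: H => l kl; have [] := ratr_cf_convergent_dist R a_gt0 kl.
move=> le_xy.
have cvg_xy : `|x * (ratr (cf_convergent a l) : R) - y| @[l --> \oo]
    --> `|x * cf_infinite R a - y|.
  by apply: cvg_norm; apply: cvgB (cvg_cst _); apply: cvgM (cvg_cst _) _.
rewrite -(cvg_lim _ cvg_xy)//; apply: limr_le; first exact: cvgP cvg_xy.
by near=> l; apply: le_xy; near: l; exact: nbhs_infty_ge.
Unshelve. all: end_near.
Qed.

(** * Distance to the nearest integer and the Lagrange constant *)

Lemma dist_int_ge0 (R : realType) (x : R) : 0 <= dist_int x.
Proof.
apply: lb_le_inf; first by exists `|x - 0%:~R|, 0.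
by move=> _ [k _ <-].
Qed.

Lemma dist_int_le (R : realType) (x : R) (k : int) : dist_int x <= `|x - k%:~R|.
Proof.
apply: ge_inf; last by exists k.
by exists 0 => _ [l _ <-].
Qed.

Lemma lagrange_constant_ge0 (R : realType) (x : R) :
  (0 <= lagrange_constant x)%E.
Proof.
rewrite /lagrange_constant limn_einf_lim; apply: lime_ge.
  exact: is_cvg_einfs.
apply: nearW => n; apply: le_ereal_inf_tmp => _ [k _ <-].
by rewrite lee_fin mulr_ge0// dist_int_ge0.
Qed.

(** Every tail of the sequence contains a value at most C, so every tail infimum is at most C. *)
Lemma lagrange_constant_le (R : realType) (x C : R) :
  (forall K : nat, exists q : nat,
     (K <= q)%N /\ q%:R * dist_int (q%:R * x) <= C) ->
  (lagrange_constant x <= C%:E)%E.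
Proof.
move=> freq; rewrite /lagrange_constant limn_einf_lim.
apply: lime_le; first exact: is_cvg_einfs.
apply: nearW => K; have [q [Kq le_qC]] := freq K.
apply: (@le_trans _ _ (q%:R * dist_int (q%:R * x))%:E); last exact: le_qC.
by apply: ereal_inf_lbound; exists q.
Qed.

(** * Recurrent words and products in a finite group *)

Lemma occurs_at_prefix (T : Type) (w : nat -> T) (L i : nat) :
  occurs_at w (mkseq w L) i <-> forall k, (k < L)%N -> w (i + k)%N = w k.
Proof.
rewrite /occurs_at size_mkseq -[i in iota i _]addn0 iotaDl -map_comp -eq_in_map.
by split => eq_w k; have := eq_w k; rewrite mem_iota.
Qed.

Lemma recurrent_prod1 (gT : finGroupType) (T : Type) (g : T -> gT)
    (w : nat -> T) (N : nat) :
  recurrent_word w ->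
  exists2 j, (N <= j)%N & (\prod_(b <- mkseq w j) g b)%g = 1%g.
Proof.
move=> w_rec.
pose phi j := (\prod_(b <- mkseq w j) g b)%g.
(* [returns] is stable under products: look for the return of x with a window
   long enough to contain the return of y. *)
pose returns x := forall L, exists j,
  [/\ (L <= j)%N, phi j = x & occurs_at w (mkseq w L) j].
have returnsM x y : returns x -> returns y -> returns (x * y)%g.
  move=> rx ry L; have [i [Li <- occ_i]] := ry L.
  have [j [Lj <- occ_j]] := rx (i + L)%N.
  move/occurs_at_prefix in occ_i; move/occurs_at_prefix in occ_j.
  exists (j + i)%N; split; first lia.
    (* The i letters from position j on repeat the first i letters, so [phi (j + i)] splits as
       [phi j * phi i]. *)
    rewrite -/(phi j) /phi {1}/mkseq iotaD map_cat big_cat/=; congr (_ * _)%g.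
    rewrite -[j in iota j _]addn0 iotaDl -map_comp; congr bigop.
    apply/eq_in_map => k; rewrite mem_iota => /andP[_ ki]/=.
    by apply: occ_j; lia.
  apply/occurs_at_prefix => k kL.
  by rewrite -addnA occ_j ?occ_i// ltn_add2l.
(* Otherwise each x fails from some length [L x] on. A return of the prefix of length M, the maximum
   of [L], at some j >= M contradicts this for x = [phi j]. *)
have [x rx] : exists x, returns x.
  apply: contrapT => /forallNP no.
  have {no} /choice[L noL] : forall x, exists L, forall j,
      (L <= j)%N -> phi j = x -> ~ occurs_at w (mkseq w L) j.
    move=> x; have /existsNP[L noL] := no x; exists L => j Lj pj occ.
    by apply: noL; exists j.
  pose M := (\max_x L x)%N.
  have [j Mj /occurs_at_prefix occ_j] :
      exists2 j, (M <= j)%N & occurs_at w (mkseq w M) j.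
    apply: contrapT => no; apply: (w_rec (mkseq w M)).
      by exists 0%N; apply/occurs_at_prefix.
    apply: sub_finite_set (finite_II M) => j /= occ_j.
    by rewrite ltnNge; apply/negP => Mj; apply: no; exists j.
  have LM : (L (phi j) <= M)%N by exact: leq_bigmax.
  apply: (noL (phi j) j) => //; first exact: leq_trans LM Mj.
  by apply/occurs_at_prefix => k kL; apply: occ_j; exact: leq_trans LM.
have rX k : returns (x ^+ k.+1)%g.
  by elim: k => [//|k IH]; rewrite expgS; exact: returnsM.
have [j [Nj pj _]] := rX #[x]%g.-1 N.
by exists j => //; rewrite -/(phi j) pj prednK ?order_gt0// expg_order.
Qed.

(** * Periodicity of the denominators modulo n *)

Definition cf_step_mod (n b : nat) (v : 'Z_n * 'Z_n) : 'Z_n * 'Z_n :=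
  (v.2, b%:R * v.2 + v.1).

Lemma cf_step_mod_inj (n b : nat) : injective (@cf_step_mod n b).
Proof.
move=> [x y] [x1 y1] /eqP; rewrite xpair_eqE /= => /andP[/eqP <-].
by move=> /eqP /addrI ->.
Qed.

(** Permutations compose from left to right, so the first letter acts first, as in [foldl]. *)
Lemma prod_cf_step_mod (n : nat) (s : seq nat) (v : nat * nat) :
  (\prod_(b <- s) perm (@cf_step_mod_inj n b))%g (v.1%:R, v.2%:R) =
  ((foldl cf_step v s).1%:R, (foldl cf_step v s).2%:R).
Proof.
elim: s v => [|b s IH] v /=; first by rewrite big_nil perm1.
by rewrite big_cons permM permE -IH /cf_step_mod/= natrD natrM.
Qed.

Lemma cf_rec_periodic_mod (a : nat -> nat) (m n N : nat) :
  recurrent_word (fun k => a (m + 1 + k)%N) -> (0 < n)%N ->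
  exists j, [/\ (N <= j)%N,
    (cf_rec (0, 1)%N a (m + j)).1 = (cf_rec (0, 1)%N a m).1 %[mod n] &
    (cf_rec (0, 1)%N a (m + j)).2 = (cf_rec (0, 1)%N a m).2 %[mod n]].
Proof.
(* The case n = 1 is separate because ['Z_1] has two elements. *)
move=> a_rec; case: n => [//|[_|n' _]]; first by exists N; rewrite !modn1.
set n := n'.+2; have n_gt1 : (1 < n)%N by [].
have [j Nj] := recurrent_prod1 (fun b => perm (@cf_step_mod_inj n b)) N a_rec.
rewrite (_ : mkseq _ j = [seq a i | i <- iota m.+1 j]); last first.
  rewrite -[m.+1]addn0 iotaDl -map_comp.
  by apply: eq_map => k; rewrite /= addn1.
set q := cf_rec (0, 1)%N a m.
move/(congr1 (fun g : {perm _} => g (q.1%:R, q.2%:R))).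
rewrite prod_cf_step_mod perm1 -cf_recD => eq_q; exists j; split=> //.
  by have := congr1 (fun z => val z.1) eq_q; rewrite /= !val_Zp_nat.
by have := congr1 (fun z => val z.2) eq_q; rewrite /= !val_Zp_nat.
Qed.

(** * From good denominators divisible by n to the Lagrange constant *)

Lemma lagrange_constant_le_approx (R : realType) (x : R) (n A : nat) :
  (0 < n)%N -> (0 < A)%N ->
  (forall N : nat, exists (D Y : nat) (P : int),
     [/\ (0 < D <= A * Y)%N, (n %| D)%N, (N <= Y)%N &
         `|D%:R * x - P%:~R| <= 2 * A%:R / Y%:R]) ->
  (lagrange_constant (n%:R * x) <= (2 * A%:R ^+ 2 / n%:R)%:E)%E.
Proof.
move=> n_gt0 A_gt0 approx; apply: lagrange_constant_le => K.
have [D [Y [P [/andP[D_gt0 DY] /dvdnP[t Dt] NY le_xP]]]] :=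
  approx (K.+1 ^ 3 * n)%N.
have nR : 0 < n%:R :> R by rewrite ltr0n.
have AR : 1 <= A%:R :> R by rewrite ler1n.
have YR : 0 < Y%:R :> R by rewrite ltr0n (leq_trans _ NY)//; lia.
have t_gt0 : (0 < t)%N by lia.
have dist_le (c : nat) :
    dist_int ((c * t)%:R * (n%:R * x)) <= c%:R * (2 * A%:R / Y%:R).
  apply: le_trans (dist_int_le _ (c%:Z * P)) _.
  rewrite (_ : _ - _ = c%:R * (D%:R * x - P%:~R)).
    by rewrite normrM normr_nat ler_wpM2l.
  by rewrite Dt !natrM intrM -pmulrn; ring.
have le_C (c : R) : c * n%:R <= A%:R * Y%:R ->
    c * (2 * A%:R / Y%:R) <= 2 * A%:R ^+ 2 / n%:R.
  move=> le_c; rewrite ler_pdivlMr// mulrAC mulrA ler_pdivrMr//.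
  by have := ler_wpM2r (ltW (lt_le_trans ltr01 AR)) le_c; nra.
(* When D / n is too small to be a new denominator, its multiple K D / n serves,
   since ||D alpha|| is tiny compared with K^(-3). *)
case: (leqP K t) => Kt.
  exists t; split => //; have := dist_le 1%N; rewrite mul1n mul1r => le_t.
  apply: le_trans (ler_wpM2l (ler0n _ _) le_t) (le_C _ _).
  by rewrite -!natrM -Dt ler_nat.
exists (K * t)%N; split; first by rewrite leq_pmulr.
apply: le_trans (ler_wpM2l (ler0n _ _) (dist_le K)) _.
rewrite [leLHS]mulrA le_C// -!natrM ler_nat.
have le_K3 : (K * t * K <= K.+1 ^ 3)%N.
  by rewrite !expnS expn0 muln1 mulnA !leq_mul//; lia.
apply: leq_trans (leq_pmull _ A_gt0); apply: leq_trans NY.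
by rewrite leq_mul2r le_K3 orbT.
Qed.

Theorem theorem3p3 (R : realType) (a : nat -> nat)
    (a_gt0 : forall k : nat, (1 <= k)%N -> (0 < a k)%N)
    (m : nat) (a_rec : recurrent_word (fun k : nat => a (m + 1 + k)%N)) :
  let alpha : R := cf_infinite R a in
  (lagrange_constant (n%:R * alpha) @[n --> \oo] --> 0%E) /\
  (forall n : nat, (1 <= n)%N ->
     (lagrange_constant (n%:R * alpha)
        <= (8 * (cf_denom a m)%:~R ^+ 2 / n%:R)%:E)%E).
Proof.
move=> alpha.
have bound n : (1 <= n)%N -> (lagrange_constant (n%:R * alpha)
    <= (8 * (cf_denom a m)%:~R ^+ 2 / n%:R)%:E)%E.
  move=> n_gt0; rewrite (cf_denomE m a_gt0) -pmulrn.
  set A := (cf_rec (0, 1)%N a m).2; set B := (cf_rec (0, 1)%N a m).1.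
  have [BA A_gt0] : (B <= A)%N /\ (0 < A)%N by exact: cf_den_mono.
  (* The argument yields the constant 2, which is stronger than 8. *)
  apply: (@le_trans _ _ (2 * A%:R ^+ 2 / n%:R)%:E); last first.
    by rewrite lee_fin !ler_pM2r ?invr_gt0 ?exprn_gt0 ?ltr0n// ler_nat.
  apply: lagrange_constant_le_approx => // N.
  (* The [+ 2] provides the index gap that [cf_den_ltn] asks for. *)
  have [j [Nj eqX eqY]] := cf_rec_periodic_mod (N + 2) a_rec n_gt0.
  set X := (cf_rec (0, 1)%N a (m + j)).1 in eqX.
  set Y := (cf_rec (0, 1)%N a (m + j)).2 in eqY.
  have [le_X le_Y] := cf_infinite_dist R (m + j) a_gt0.
  rewrite -/X -/Y -/alpha in le_X le_Y.
  have [XY Y_gt0] : (X <= Y)%N /\ (0 < Y)%N by exact: cf_den_mono.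
  have AY : (A < Y)%N by apply: cf_den_ltn => //; lia.
  set S := (cf_rec (1, 0)%N a (m + j)).1 in le_X.
  set T := (cf_rec (1, 0)%N a (m + j)).2 in le_Y.
  (* Modulo n, X = B and Y = A, hence D = AB - BA = 0. Also D alpha - P = A (X alpha - S) - B (Y
     alpha - T), where both brackets are at most 1/Y in absolute value and B <= A. *)
  pose P := A%:Z * S%:Z - B%:Z * T%:Z.
  pose D := A%:Z * X%:Z - B%:Z * Y%:Z.
  exists `|D|%N, Y, (sgz D * P); split.
  - rewrite absz_gt0 subr_eq0 -!PoszM eqz_nat; apply/andP; split.
      (* If AX = BY, then Y divides A because X and Y are coprime, against A < Y. *)
      apply: contraTneq AY => AXBY; rewrite -leqNgt dvdn_leq//.
      rewrite -(@Gauss_dvdl _ _ X) 1?coprime_sym ?coprime_cf_den// AXBY.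
      exact: dvdn_mull.
    (* Both AX and BY lie between 0 and AY, so their difference is at most AY in absolute value. *)
    have := leq_mul BA (leqnn Y); have := leq_mul (leqnn A) XY.
    by rewrite /D -!PoszM; lia.
  - rewrite -[(n %| _)%N]/(n%:Z %| D)%Z -eqz_mod_dvd -!PoszM !modz_nat eqz_nat.
    by apply/eqP; rewrite -modnMmr eqX -[RHS]modnMmr eqY !modnMmr mulnC.
  - by apply: (@leq_trans (m + j)); [lia|exact: cf_den_geq].
  have -> : `|D|%:R * alpha - (sgz D * P)%:~R =
      (sgz D)%:~R * (D%:~R * alpha - P%:~R) :> R.
    by rewrite pmulrn abszEsg !rmorphM /= mulrBr mulrA.
  have -> : D%:~R * alpha - P%:~R =
      A%:R * (X%:R * alpha - S%:R) - B%:R * (Y%:R * alpha - T%:R).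
    by rewrite /D /P !rmorphB !rmorphM /= -!pmulrn; ring.
  have sgz_le1 : `|(sgz D)%:~R| <= 1 :> R.
    by rewrite -intr_norm normr_sgz lerz1; case: eqP.
  rewrite normrM (le_trans (ler_piMl _ sgz_le1))// (le_trans (ler_normB _ _))//.
  rewrite !normrM !normr_nat -[2 * _ / _]mulrA [leRHS]mulr_natl mulr2n.
  by rewrite lerD ?ler_pM// ler_nat.
split=> //.
apply: (@squeeze_cvge _ _ _ _ (cst 0%E) _
  (fun n => (8 * (cf_denom a m)%:~R ^+ 2 / n%:R)%:E)); last 2 first.
- exact: cvg_cst.
- apply: cvg_EFin; first exact: nearW.
  rewrite -(mulr0 (8 * (cf_denom a m)%:~R ^+ 2)).
  apply: cvgM; first exact: cvg_cst.
  apply/gtr0_cvgV0; last exact: cvgr_idn.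
  by near=> n; rewrite ltr0n; near: n; exact: nbhs_infty_gt.
near=> n; rewrite lagrange_constant_ge0 bound//.
by near: n; exact: nbhs_infty_ge.
Unshelve. all: end_near.
Qed.
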